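(* Let $\tau=t_1,t_2,\dots,t_k$ be a sequence of integers with $m\geq t_1\geq t_2\geq\cdots\geq t_k\geq 1$. Then $$I_{t_1}\cdots I_{t_k}=\bigcap_{j=1}^{t_1} I_j^{(\gamma_j(\tau))},$$ and this is a (possibly redundant) primary decomposition of $I_{t_1}\cdots I_{t_k}$.
   Context: Let $\mathbb{K}$ be a field, let $n\ge 1$ and $c\geq 1$ be integers, and let $R=\mathbb{K}[x_1,\dots,x_n]$. Set $m=\lfloor \frac{n+c}{c+1}\rfloor$. For $1\le t\le m$ let $X_t$ be the $t\times (n-(t-1)c)$ matrix whose $(i,j)$ entry is $x_{j+(i-1)c}$, and let $I_t\subset R$ be the ideal generated by all $t$-minors of $X_t$. Each $I_t$ is a prime ideal, and $I^{(s)}=R\cap I^sR_I$ denotes the $s$th symbolic power of a prime ideal $I$ of $R$. For a sequence of integers $\tau=t_1,\dots,t_k$ and $j\ge 1$, set $\gamma_j(\tau)=\sum_{i=1}^k\max\{t_i+1-j,0\}$. *)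

(* Defs.v *)
(* Ideals are classical subsets [set R] of a commutative ring. *)
From mathcomp Require Import all_boot all_order all_algebra.
From mathcomp Require Import boolp classical_sets cardinality.
From mathcomp Require Import mpoly.

Set Implicit Arguments.
Unset Strict Implicit.
Unset Printing Implicit Defensive.

Import GRing.Theory.

Local Open Scope classical_set_scope.
Local Open Scope ring_scope.

Section Ideals.
Variable R : comNzRingType.
Implicit Types (I J Q G : set R).

(* Unlike [idealr_closed] of ring_quotient, the unit ideal is allowed. *)
Definition is_ideal I : Prop :=
  [/\ I 0, forall a b, I a -> I b -> I (a + b) & forall a b, I b -> I (a * b)].

Definition ideal_gen G : set R := smallest is_ideal G.

Definition ideal_mul I J : set R :=
  ideal_gen [set x | exists a b, [/\ I a, J b & x = a * b]].

Definition ideal_prod (s : seq (set R)) : set R := foldr ideal_mul setT s.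

Definition ideal_exp I (s : nat) : set R := ideal_prod (nseq s I).

Definition primary_ideal Q : Prop :=
  [/\ is_ideal Q, Q <> setT
    & forall a b, Q (a * b) -> Q a \/ exists e : nat, Q (b ^+ e)].

(* The family [Q j], for [j] in [D], is a primary decomposition of [I]; neither
   irredundance nor distinctness of the radicals is required. *)
Definition primary_decomposition (I : set R) (D : set nat) (Q : nat -> set R) :
    Prop :=
  [/\ finite_set D, forall j, D j -> primary_ideal (Q j)
    & I = \bigcap_(j in D) Q j].

(* The r-minors of [A]: rows and columns are chosen in increasing order. *)
Definition minors (r p q : nat) (A : 'M[R]_(p, q)) : set R :=
  [set x | exists (f : 'I_r -> 'I_p) (g : 'I_r -> 'I_q),
     [/\ {homo f : i j / (i < j)%N}, {homo g : i j / (i < j)%N}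
       & x = \det (mxsub f g A)]].

End Ideals.

Local Notation "x %:F" := (tofrac x).

Section SymbolicPower.
Variable R : idomainType.
Implicit Types (I J P : set R).

(* The localization R_P, as a subring of the fraction field of the domain R
   (P is meant to be a prime ideal). *)
Definition localization P : set {fraction R} :=
  [set x | exists a b : R, ~ P b /\ x = a%:F / b%:F].

(* The extension J R_P: all finite sums of products of an element of J and an
   element of R_P. *)
Definition ext_ideal P J : set {fraction R} :=
  [set x | exists s : seq (R * {fraction R}),
     (forall p, p \in s -> J p.1 /\ localization P p.2)
     /\ x = \sum_(p <- s) p.1%:F * p.2].

Definition symbolic_power I (s : nat) : set R :=
  [set f : R | ext_ideal I (ideal_exp I s) f%:F].

End SymbolicPower.

Section Hankel.
Variables (K : fieldType) (n c : nat).

Lemma hankel_index_lt t (i : 'I_t) (j : 'I_(n - (t - 1) * c)) : (j + i * c < n)%N.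
Proof.
have: (j < n - (t - 1) * c)%N by [].
rewrite ltn_subRL; apply: leq_ltn_trans; rewrite addnC leq_add2r leq_mul2r.
by rewrite subn1 -ltnS (leq_trans (ltn_ord i)) ?leqSpred ?orbT.
Qed.

(* The matrix X_t, with rows, columns and variables numbered from 0: the entry
   (i, j) is the variable of index j + i * c. *)
Definition hankel_mx t : 'M[{mpoly K[n]}]_(t, n - (t - 1) * c) :=
  \matrix_(i, j) 'X_(Ordinal (hankel_index_lt i j)).

Definition hankel_ideal t : set {mpoly K[n]} :=
  ideal_gen (minors t (hankel_mx t)).

End Hankel.

Arguments hankel_mx K n c t : clear implicits.
Arguments hankel_ideal K n c t : clear implicits.

Definition gamma (j : nat) (tau : seq nat) : nat :=
  (\sum_(t <- tau) (t + 1 - j))%N.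

(* Main.v *)
(* Let V_j be the (j-1)-secant variety of the locus where the X_t have rank at
   most 1.  For a generic point y of V_j and a generic direction x, the order in
   eps of f(y + eps x) is a valuation; write Q_j(s) for the set of f of order at
   least s, an ideal primary to Q_j(1).  A t-minor lies in Q_j(t + 1 - j), which
   gives one inclusion with Q_j(s) in place of the symbolic power I_j^(s).
   Conversely, if F is a union of j-1 disjoint
   intervals of c+1 consecutive variables, y can be degenerated to a point
   supported on F, and this shows that the leading monomial of every f in Q_j(s)
   has degree at least s outside F.  A min-max argument turns these lower bounds,
   over all j and F, into a factorization of the leading monomial of f in the
   intersection of the Q_j into diagonals of minors of sizes t_1, ..., t_k and a
   cofactor, and f is reduced to 0 by subtracting multiples of products of minors.
   The same reduction gives I_j = Q_j(1), and applied to d^(2s) f, for d a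
   (j-1)-minor and f in Q_j(s), it gives d^(2s) f in I_j^s; hence
   I_j^(s) = Q_j(s). *)
Require Import Defs.
From mathcomp Require Import all_boot all_order all_algebra all_fingroup.
From mathcomp Require Import boolp classical_sets cardinality.
From mathcomp Require Import mpoly.
From mathcomp Require Import zify ring.

Set Implicit Arguments.
Unset Strict Implicit.
Unset Printing Implicit Defensive.

Import Order.TTheory GRing.Theory.

(** * Chains of indices with gaps larger than [c], and covers by intervals *)

Section Chains.
Variable c : nat.

Definition far (y x : nat) : bool := x + c < y.

Lemma far_trans : transitive far.
Proof. by rewrite /far => y x z /= ? ?; lia. Qed.

(* [e] is the right end of the interval [[e - c, e]]. *)
Definition covered (F : seq nat) (x : nat) : bool :=
  has (fun e => x <= e <= x + c) F.

Lemma covered_cons e F x : covered (e :: F) x = (x <= e <= x + c) || covered F x.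
Proof. by []. Qed.

(** Take the largest element [b], discard everything in [[b - c, b]], and repeat. *)
Lemma max_chain_covers (L : seq nat) : sorted geq L ->
  exists F, [/\ {subset F <= L}, sorted far F & all (covered F) L].
Proof.
have [N] := ubnP (size L); elim: N => // N IH in L *.
case: L => [|b L] /=; first by exists [::].
rewrite ltnS => leLN; rewrite path_sortedE; last exact: rev_trans leq_trans.
case/andP=> /allP leL srtL.
have [||F [FL srtF /allP covF]] := IH [seq x <- L | far b x].
- by rewrite size_filter (leq_ltn_trans (count_size _ _)).
- exact: sorted_filter (rev_trans leq_trans) _ _ srtL.
exists (b :: F); split.
- move=> x; rewrite !inE => /predU1P[->|/FL]; first by rewrite eqxx.
  by rewrite mem_filter => /andP[_ ->]; rewrite orbT.
- rewrite /= path_sortedE ?srtF ?andbT; last exact: far_trans.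
  by apply/allP=> x /FL; rewrite mem_filter => /andP[].
- rewrite [all _ _]/= covered_cons leqnn leq_addr; apply/allP => x xL.
  rewrite covered_cons; have := leL _ xL; rewrite /geq /= => ->.
  have [//|lt] := leqP b (x + c).
  by apply: covF; rewrite mem_filter xL andbT.
Qed.

(** * Packing a multiset of indices into [k] chains of prescribed sizes *)

Section Greedy.
Variables (k : nat) (t : 'I_k -> nat).
Implicit Types (C : 'I_k -> seq nat) (L F : seq nat).

Definition need C i := t i - size (C i).

Definition avail b C i := (0 < need C i) && (if C i is y :: _ then far b y else true).

(* Elements are offered in increasing order (the list is decreasing), and go to
   the available chain that still needs the most elements. *)
Definition neediest b C : option 'I_k :=
  [pick i | avail b C i & [forall i', avail b C i' ==> (need C i' <= need C i)]].

Definition greedy_step b C : 'I_k -> seq nat :=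
  if neediest b C is Some i then fun i' => if i' == i then b :: C i' else C i'
  else C.

Definition greedy L := foldr greedy_step (fun=> [::]) L.

(** This is [gamma j] of the sizes still missing; at [j = 1] it vanishes exactly when all chains are
    full. *)
Definition demand j L := \sum_i (need (greedy L) i + 1 - j).

Variant neediest_spec b C : option 'I_k -> Type :=
| Neediest i of avail b C i & (forall i', avail b C i' -> need C i' <= need C i) :
    neediest_spec b C (Some i)
| NeediestNone of (forall i, ~~ avail b C i) : neediest_spec b C None.

Lemma neediestP b C : neediest_spec b C (neediest b C).
Proof.
rewrite /neediest; case: pickP => [i /andP[av /forallP mx]|none].
  by constructor=> // i'; apply/implyP.
constructor=> i; apply/negP => av.
have := none [arg max_(i' > i | avail b C i') need C i'].
case: arg_maxnP => // i0 av0 mx /negP; apply.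
by rewrite av0; apply/forallP => i'; apply/implyP/mx.
Qed.

Lemma greedy_far L i : sorted far (greedy L i).
Proof.
elim: L => //= b L IH; rewrite /greedy_step.
case: neediestP => [i0 /andP[_ rd] _|//]; have [ii0|//] := eqVneq i i0.
by rewrite ii0 in IH *; case: (greedy L i0) rd IH => //= y s -> ->.
Qed.

Lemma greedy_size L i : size (greedy L i) <= t i.
Proof.
elim: L => //= b L IH; rewrite /greedy_step.
case: neediestP => [i0 /andP[+ _] _|//]; have [->|//] := eqVneq i i0.
by rewrite /need subn_gt0.
Qed.

Lemma greedy_count L x :
  \sum_i count_mem x (greedy L i) <= count_mem x L.
Proof.
elim: L => [|b L IH] /=; first by rewrite big1.
rewrite /greedy_step; case: neediestP => [i0 _ _|_]; last exact: leq_trans (leq_addl _ _).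
rewrite (bigD1 i0) //= eqxx /= -addnA leq_add2l.
apply: leq_trans IH; rewrite [X in _ <= X](bigD1 i0) //= leq_add2l.
by apply: leq_sum => i /negPf ->.
Qed.

Lemma greedy_cat A L i :
  exists2 B, greedy (A ++ L) i = B ++ greedy L i & {subset B <= A}.
Proof.
elim: A => [|b A [B E BA]] /=; first by exists [::].
rewrite /greedy_step; case: neediestP => [i0 _ _|_]; last first.
  by exists B => // x /BA; rewrite inE orbC => ->.
case: eqP => _; last by exists B => // x /BA; rewrite inE orbC => ->.
exists (b :: B); first by rewrite E.
by move=> x; rewrite !inE => /predU1P[->|/BA ->]; rewrite ?eqxx ?orbT.
Qed.

Lemma greedy_sub L i : {subset greedy L i <= L}.
Proof.
by have [B] := greedy_cat L [::] i; rewrite !cats0 => ->.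
Qed.

(** As [L] decreases, the elements far below [b] form a suffix, which is the part that [greedy]
    processes first. *)
Lemma filter_far_split b L : sorted geq L ->
  L = [seq x <- L | ~~ far b x] ++ [seq x <- L | far b x].
Proof.
elim: L => //= a L IH; rewrite path_sortedE; last exact: rev_trans leq_trans.
case/andP=> /allP leL /IH E; have [fa|_] /= := boolP (far b a); last by rewrite -E.
suff aL: all (far b) L.
  by rewrite (all_filterP aL) (eq_in_filter (a2 := pred0)) ?filter_pred0 // => x /(allP aL) ->.
by apply/allP => x /leL; move: fa; rewrite /far /geq /=; lia.
Qed.

(* If [b] does not go to a chain needing at least [j] elements, then all those
   chains were busy, so each has received an element of the window [[b - c, b]]. *)
Lemma demand_cons j b L : 0 < j -> sorted geq L ->
  (demand j (b :: L)).+1 = demand j L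
  \/ demand j (b :: L) <= demand j.+1 [seq x <- L | far b x].
Proof.
move=> j0 srtL.
have busy i : j <= need (greedy L) i -> ~~ avail b (greedy L) i ->
    need (greedy L) i + 1 - j <= need (greedy [seq x <- L | far b x]) i + 1 - j.+1.
  move=> ji; rewrite /avail (leq_trans j0 ji) /=.
  have [B E _] := greedy_cat [seq x <- L | ~~ far b x] [seq x <- L | far b x] i.
  rewrite -filter_far_split // in E; move: ji; rewrite /need E size_cat.
  case: B E => [|y B] /= E; last by lia.
  have := @greedy_sub [seq x <- L | far b x] i.
  by case: (greedy _ _) => //= y s /(_ y (mem_head _ _)); rewrite mem_filter => /andP[-> _].
rewrite /demand /=; rewrite /greedy_step; case: neediestP => [i0 av0 mx|nav]; last first.
  right; apply: leq_sum => i _; have [ji|] := leqP j (need (greedy L) i); last by lia.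
  exact: busy.
have [ji0|ji0] := leqP j (need (greedy L) i0).
  left; rewrite (bigD1 i0) //= [in RHS](bigD1 i0) //= -addSn; congr (_ + _).
    by move: ji0; rewrite /need eqxx /=; lia.
  by apply: eq_bigr => i /negPf ni; rewrite /need ni.
right; apply: leq_sum => i _; rewrite {1}/need; have [->|ni] := eqVneq i i0.
  by move: ji0; rewrite /need /=; lia.
rewrite -/(need (greedy L) i).
have [ji|] := leqP j (need (greedy L) i); last by lia.
by apply: busy => //; apply/negP => /mx; lia.
Qed.

(* Unwinding [demand_cons] yields the dual certificate [F]: one interval is spent
   at each step of the second kind. *)
Lemma demand_cover L j : 0 < j -> sorted geq L ->
  exists F, [/\ {subset F <= L}, sorted far F
    & demand j L + count (predC (covered F)) L <= \sum_i (t i + 1 - (j + size F))].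
Proof.
have [N] := ubnP (size L); elim: N => // N IH in L j *.
case: L => [|b L] /=.
  by exists [::]; split=> //=; rewrite addn0 /demand addn0 leq_sum // => i _; rewrite /need /= subn0.
rewrite ltnS => leLN j0 srt; have srtL := path_sorted srt.
have [st|st] := demand_cons b j0 srtL.
  have [F [FL sF dF]] := IH L j leLN j0 srtL.
  exists F; split=> //; first by move=> x /FL; rewrite inE orbC => ->.
  by apply: leq_trans dF; rewrite -st /=; case: (~~ _); lia.
have [|//||F [FL sF dF]] := IH [seq x <- L | far b x] j.+1.
- by rewrite size_filter (leq_ltn_trans (count_size _ _)).
- exact: sorted_filter (rev_trans leq_trans) _ _ srtL.
move: srt; rewrite path_sortedE; last exact: rev_trans leq_trans.
case/andP=> /allP leL _.
exists (b :: F); split.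
- move=> x; rewrite !inE => /predU1P[->|/FL]; first by rewrite eqxx.
  by rewrite mem_filter => /andP[_ ->]; rewrite orbT.
- rewrite /= path_sortedE ?sF ?andbT; last exact: far_trans.
  by apply/allP=> x /FL; rewrite mem_filter => /andP[].
- rewrite /= addnS -addSn; apply: leq_trans dF; apply: leq_add => //.
  rewrite leqnn leq_addr /= add0n count_filter.
  rewrite (eq_in_count (a2 := predI (predC (covered F)) (far b))) //.
  move=> x xL; rewrite /= negb_or andbC; congr (_ && _).
  by have := leL _ xL; rewrite /geq /= => -> /=; rewrite -ltnNge.
Qed.

End Greedy.

End Chains.

Local Open Scope classical_set_scope.
Local Open Scope ring_scope.

(** * Divisibility of monomials by products of chains *)

Section Monomials.
Variable n : nat.
Implicit Types (M : 'X_{1..n}) (s : seq nat).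

Definition mnm_of_seq s : 'X_{1..n} := [multinom count_mem (val i) s | i < n].

Definition seq_of_mnm M : seq nat :=
  sort geq (flatten [seq nseq (M i) (val i) | i <- enum 'I_n]).

Lemma sorted_seq_of_mnm M : sorted geq (seq_of_mnm M).
Proof. by apply: sort_sorted => x y; exact: leq_total. Qed.

Lemma count_seq_of_mnm M (P : pred nat) :
  count P (seq_of_mnm M) = (\sum_i M i * P i)%N.
Proof.
rewrite /seq_of_mnm (seq.permP (permEl (perm_sort _ _))) count_flatten -map_comp.
rewrite sumnE big_map big_enum; apply: eq_bigr => i _ /=.
by rewrite count_nseq mulnC.
Qed.

Lemma count_mem_seq_of_mnm M (i : 'I_n) : count_mem (val i) (seq_of_mnm M) = M i.
Proof.
rewrite count_seq_of_mnm (bigD1 i) //= eqxx muln1 big1 ?addn0 // => j /negPf ji.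
by rewrite /= val_eqE ji muln0.
Qed.

Lemma seq_of_mnm_lt M x : x \in seq_of_mnm M -> (x < n)%N.
Proof.
rewrite mem_sort => /flattenP[s /mapP[i _ ->]].
by rewrite mem_nseq => /andP[_ /eqP ->]; exact: ltn_ord.
Qed.

(** Chains play two roles: main diagonals of minors, and right ends of disjoint intervals. *)
Definition chain c s := sorted (far c) s && all (gtn n) s.

(** Run [greedy] on the indices of [M]. For its certificate [F] at [j = 1], the number of missing
    elements plus the degree of [M] outside [F] is at most the left side of the hypothesis, so
    nothing is missing. *)
Lemma mnm_chains c k (t : 'I_k -> nat) M :
    (forall F, chain c F ->
       \sum_i (t i - size F) <= \sum_(i < n | ~~ covered c F i) M i)%N ->
  exists C : 'I_k -> seq nat,
    (forall i, chain c (C i) /\ size (C i) = t i)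
    /\ exists M', M = (M' + \sum_i mnm_of_seq (C i))%MM.
Proof.
move=> tM; set L := seq_of_mnm M; exists (greedy c t L).
have sub i x : x \in greedy c t L i -> (x < n)%N.
  by move/greedy_sub/seq_of_mnm_lt.
split.
  move=> i; split; first by rewrite /chain greedy_far; apply/allP => x /sub.
  have [//|F [FL sF]] := @demand_cover c k t L 1 _ (sorted_seq_of_mnm M).
  have chF : chain c F by rewrite /chain sF; apply/allP => x /FL /seq_of_mnm_lt.
  rewrite (eq_bigr (fun i => t i - size F)%N) => [|i' _]; last by lia.
  move=> /leq_trans /(_ (tM F chF)); rewrite count_seq_of_mnm.
  rewrite [X in (_ + X <= _)%N](eq_bigr (fun i : 'I_n => if ~~ covered c F i then M i else 0%N));
    last by move=> i' _ /=; case: ifP; rewrite ?muln1 ?muln0.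
  rewrite -big_mkcond /= -[X in (_ <= X)%N]add0n leq_add2r leqn0 sum_nat_eq0.
  move=> /forallP/(_ i); rewrite /need addnK.
  by have := greedy_size c t L i; lia.
exists (M - \sum_i mnm_of_seq (greedy c t L i))%MM.
rewrite submK //; apply/mnm_lepP => i; rewrite mnm_sumE.
rewrite -count_mem_seq_of_mnm; apply: leq_trans (greedy_count _ _ _ _).
by apply: leq_sum => i' _; rewrite mnmE.
Qed.

(** The chain from [max_chain_covers] covers the support of [M], so by hypothesis it has at least
    [j] elements and can be cut to length [j]. *)
Lemma mnm_chain c j M :
    (forall F, chain c F -> (size F < j)%N ->
       exists2 i : 'I_n, (0 < M i)%N & ~~ covered c F i) ->
  exists C, [/\ chain c C, size C = j & exists M', M = (M' + mnm_of_seq C)%MM].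
Proof.
move=> HM; set L := seq_of_mnm M.
have [F [FL sF /allP cF]] := max_chain_covers c (sorted_seq_of_mnm M).
have chF : chain c F by rewrite /chain sF; apply/allP => x /FL /seq_of_mnm_lt.
have [jF|Fj] := leqP j (size F); last first.
  have [i Mi /negP[]] := HM F chF Fj; apply: cF.
  by rewrite -has_pred1 has_count count_mem_seq_of_mnm.
exists (take j F); split; last 1 first.
- exists (M - mnm_of_seq (take j F))%MM; rewrite submK //.
  apply/mnm_lepP => i; rewrite mnmE -count_mem_seq_of_mnm.
  have uF : uniq F.
    apply: sorted_uniq sF; first exact: far_trans.
    by move=> x; rewrite /far; lia.
  rewrite count_uniq_mem ?take_uniq //; case: (boolP (_ \in _)) => // /mem_take /FL.
  by rewrite -has_pred1 has_count.
- rewrite /chain take_sorted //; apply/allP => x /mem_take /FL.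
  exact: seq_of_mnm_lt.
- by rewrite size_takel.
Qed.

End Monomials.

(** * Minors: leading terms and low-rank perturbations *)

Lemma mlead_eq n (R : nzRingType) (p : {mpoly R[n]}) (m : 'X_{1..n}) :
  p@_m != 0 -> (forall m', (m < m')%O -> p@_m' = 0) -> mlead p = m.
Proof.
move=> pm0 pgt; have p0 : p != 0 by apply: contra_neq pm0 => ->; rewrite mcoeff0.
apply/le_anti/andP; split; last by apply: msupp_le_mlead; rewrite mcoeff_msupp.
rewrite leNgt; apply/negP => /pgt /eqP.
by rewrite mleadc_eq0 (negPf p0).
Qed.

(** Every permutation other than the identity gives a strictly smaller monomial, so the diagonal
    term cannot cancel even if entries repeat. *)
Lemma det_mpolyX_lead n (R : comNzRingType) t (e : 'I_t -> 'I_t -> 'I_n)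
    (d := \det (\matrix_(i, j) ('X_(e i j) : {mpoly R[n]}))) :
    (forall i, {homo e i : j j' / (j < j')%N}) ->
    (forall j, {homo e^~ j : i i' / (i < i')%N}) ->
  mlead d = (\sum_i U_(e i i))%MM /\ mleadc d = 1.
Proof.
move=> er ec; pose ms (s : {perm 'I_t}) := (\sum_i U_(e i (s i)))%MM.
have dE : d = \sum_(s : {perm 'I_t}) (-1) ^+ s * 'X_[ms s].
  apply: eq_bigr => s _; congr (_ * _).
  rewrite /ms (big_morph _ (@mpolyXD n R) (@mpolyX0 n R)).
  by apply: eq_bigr => i _; rewrite mxE.
have degms s : mdeg (ms s) = t.
  rewrite mdeg_sum (eq_bigr (fun=> 1%N)) => [|i _]; last by rewrite mdeg1.
  by rewrite sum1_card card_ord.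
have ltms s : s != 1%g -> (ms s < ms 1%g)%O.
  move=> s1; have [i1 si1] : exists i, s i != i.
    apply/existsP; apply: contraR s1 => /existsPn ns; apply/eqP/permP => i.
    by rewrite perm1; apply/eqP; have := ns i; rewrite negbK.
  (* [s] moves [i0] first; the variables it picks in rows [i0] and below are all
     smaller than the diagonal one of row [i0]. *)
  case: (@arg_minnP _ i1 (fun i => s i != i) (fun i => val i) si1) => i0 si0 min0 {i1 si1}.
  have fix0 (i : 'I_t) : (i < i0)%N -> s i = i.
    by move=> ii0; apply/eqP; apply: contraLR ii0 => /min0; rewrite -leqNgt.
  have gt0 (i : 'I_t) : (i0 <= i)%N -> (i0 <= s i)%N.
    move=> i0i; rewrite leqNgt; apply/negP => si.
    by have /perm_inj E := fix0 _ si; move: si; rewrite E ltnNge i0i.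
  have big0 (i : 'I_t) : (i0 <= i)%N -> (e i0 i0 < e i (s i))%N.
    rewrite leq_eqVlt => /predU1P[E|lt].
      have {E}<- : i0 = i by apply: val_inj.
      by apply: er; rewrite ltn_neqAle gt0 // eq_sym andbT.
    apply: leq_trans (ec i0 _ _ lt) _; rewrite leq_eqVlt.
    have := gt0 i (ltnW lt); rewrite leq_eqVlt => /predU1P[/val_inj <-|].
      by rewrite eqxx.
    by move=> /er ->; rewrite orbT.
  have big1 (i : 'I_t) : (i0 < i)%N -> (e i0 i0 < e i i)%N.
    by move=> lt; apply: ltn_trans (ec i0 _ _ lt) (er i _ _ lt).
  apply/ltmcP; first by rewrite !degms.
  exists (e i0 i0).
    move=> a aE; rewrite !mnm_sumE; apply: eq_bigr => i _; rewrite perm1 !mnm1E.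
    have [/fix0 -> //|i0i] := ltnP i i0.
    have ne (x : 'I_n) : (e i0 i0 <= x)%N -> (val x == val a) = false.
      by move: aE => /= aE ?; apply/eqP => /= E; lia.
    rewrite -!val_eqE !ne //; last exact: ltnW (big0 _ i0i).
    move: i0i; rewrite leq_eqVlt => /predU1P[/val_inj <- //|].
    by move/big1/ltnW.
  rewrite !mnm_sumE (bigD1 i0) // [X in (_ < X)%N](bigD1 i0) //= perm1.
  rewrite !mnm1E eqxx -val_eqE gtn_eqF ?big0 // add0n add1n ltnS.
  apply: leq_sum => i ni; rewrite perm1 !mnm1E.
  have [/fix0 -> //|i0i] := ltnP i i0.
  by rewrite -val_eqE gtn_eqF ?big0.
have dc m : (ms 1%g <= m)%O -> d@_m = (m == ms 1%g)%:R.
  move=> lem; rewrite dE raddf_sum (bigD1 1%g) //= odd_perm1 expr0 mul1r.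
  rewrite mcoeffX eq_sym big1 ?addr0 // => s s1.
  rewrite -signr_odd; case: (odd _); rewrite ?expr0 ?expr1 ?mulN1r ?mul1r ?mcoeffN;
  by rewrite mcoeffX lt_eqF ?oppr0 // (lt_le_trans (ltms s s1)).
have E : (\sum_i U_(e i i))%MM = ms 1%g.
  by apply: eq_bigr => i _; rewrite perm1.
have lE : mlead d = ms 1%g.
  apply: mlead_eq; first by rewrite dc // eqxx oner_neq0.
  by move=> m lt; rewrite dc ?ltW // gt_eqF.
by rewrite E lE dc // eqxx.
Qed.

Section Minor.
Variables (K : fieldType) (n c : nat).
Hypothesis c0 : (0 < c)%N.

(** Read the chain upwards and subtract [i * c] from its [i]-th element: as gaps exceed [c], the
    results increase strictly, and they are the columns of a minor with this diagonal. *)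
Lemma chain_minor (s : seq nat) : chain n c s ->
  exists d, [/\ minors (size s) (hankel_mx K n c (size s)) d,
    mlead d = mnm_of_seq n s & mleadc d = 1].
Proof.
move=> /andP[srt ltn]; set t := size s.
pose a i := nth 0%N (rev s) i.
have an i : (i < t)%N -> (a i < n)%N.
  move=> it; have : a i \in s by rewrite -mem_rev mem_nth // size_rev.
  by move/(allP ltn).
have rsrt : sorted (fun x y => far c y x) (rev s) by rewrite rev_sorted.
have astep i : (i.+1 < t)%N -> (a i + c < a i.+1)%N.
  by move=> it; have /sortedP := rsrt; apply; rewrite size_rev.
have afar d i : (i + d < t)%N -> (a i + d * c.+1 <= a (i + d))%N.
  elim: d => [|d IH]; first by rewrite !addn0.
  rewrite addnS => lt; have := astep _ lt; have := IH (ltnW lt).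
  by rewrite mulSn; lia.
have afar0 i : (i < t)%N -> (i * c.+1 <= a i)%N.
  by move=> it; apply: leq_trans (afar i 0%N it); rewrite leq_addl.
(* The [t - 1 - j] later elements each take [c + 1] more indices below [n], which bounds the
   column. *)
have ag (j : 'I_t) : (a j - j * c < n - (t - 1) * c)%N.
  have jt := ltn_ord j; have t0 : (0 < t)%N by apply: leq_ltn_trans jt.
  have lt : (j + (t.-1 - j) < t)%N by lia.
  have := afar _ _ lt; have := afar0 j jt; have := an _ lt.
  have -> : ((t - 1) * c = j * c + (t.-1 - j) * c)%N by rewrite -mulnDl; congr (_ * _)%N; lia.
  by rewrite !mulnS; lia.
pose g (j : 'I_t) := Ordinal (ag j).
have gmono : {homo g : j j' / (j < j')%N}.
  move=> j j' jj' /=.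
  have lt : (j + (j' - j) < t)%N by rewrite subnKC ?ltn_ord // ltnW.
  have := afar _ _ lt; have := afar0 j (ltn_ord j).
  rewrite (subnKC (ltnW jj')); have := subnKC (ltnW jj').
  move: (j' - j)%N (ltnW jj') => d _ dE; rewrite -dE mulnDl !mulnS; lia.
pose e (i j : 'I_t) := Ordinal (hankel_index_lt i (g j)).
have eii i : val (e i i) = a i.
  by have := afar0 i (ltn_ord i); rewrite /= mulnS => le; rewrite subnK //; lia.
have -> : mnm_of_seq n s = (\sum_i U_(e i i))%MM.
  apply/mnmP => b; rewrite mnm_sumE mnmE -count_rev -sum1_count (big_nth 0%N).
  rewrite size_rev big_mkord big_mkcond; apply: eq_bigr => i _.
  by rewrite mnm1E -val_eqE eii /=; case: eqP.
have [||lE cE] := @det_mpolyX_lead n K t e.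
- by move=> i j j' jj' /=; rewrite ltn_add2r; apply: gmono.
- by move=> j i i' /=; rewrite ltn_add2l ltn_pmul2r.
exists (\det (\matrix_(i, j) 'X_(e i j))); split=> //.
exists id, g; split=> //.
by congr (\det _); apply/matrixP => i j; rewrite !mxE.
Qed.
End Minor.

(** As [U *m V] has rank at most [r], this will bound below the order of a [t]-minor at a sum of [r]
    points of rank 1. *)
Lemma det_low_rank_perturbation (S : idomainType) (t r : nat) (U : 'M[S]_(t, r))
    (V : 'M[S]_(r, t)) (X : 'M[S]_t) (eps : S) : eps != 0 ->
  exists d, \det (U *m V + eps *: X) = eps ^+ (t - r) * d.
Proof.
move=> eps0; have [tr|/ltnW rt] := leqP t r.
  by exists (\det (U *m V + eps *: X)); rewrite (eqP tr) mul1r.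
(* Schur complement; multiply the first [r] columns by [eps] and extract [eps]
   from the last [t] rows. *)
pose A := block_mx (eps%:M : 'M_r) (- V) U X.
exists (\det A); apply: (mulfI (expf_neq0 r eps0)).
rewrite mulrA -exprD subnKC //.
have E1 : block_mx (1%:M : 'M_r) (- V) U (eps *: X) =
    block_mx 1%:M 0 U 1%:M *m block_mx 1%:M (- V) 0 (U *m V + eps *: X).
  rewrite mulmx_block !(mulmx0, mul0mx, mulmx1, mul1mx, addr0, add0r) mulmxN.
  by rewrite addKr.
have E2 : block_mx (1%:M : 'M_r) (- V) U (eps *: X) *m block_mx eps%:M 0 0 1%:M
    = block_mx 1%:M 0 0 eps%:M *m A.
  rewrite !mulmx_block !(mulmx0, mul0mx, mulmx1, mul1mx, addr0, add0r).
  by rewrite !(mul_mx_scalar, mul_scalar_mx).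
move: (congr1 determinant E2); rewrite E1 !det_mulmx !det_ublock !det_lblock.
by rewrite !det1 !mul1r !mulr1 !det_scalar mulrC.
Qed.

(** * Generated ideals and products of ideals *)

Section IdealFacts.
Variable R : comNzRingType.
Implicit Types (I J Q G : set R).

Lemma ideal_gen_min G Q : is_ideal Q -> G `<=` Q -> ideal_gen G `<=` Q.
Proof. by move=> idQ GQ; apply: smallest_sub. Qed.

Lemma ideal_genP G : is_ideal (ideal_gen G).
Proof.
split.
- by move=> Q [[]].
- by move=> a b Ia Ib Q QG; have [[_ QD _] _] := QG; apply: QD; [apply: Ia|apply: Ib].
- by move=> a b Ib Q QG; have [[_ _ QM] _] := QG; apply: QM; apply: Ib.
Qed.

Lemma sub_ideal_gen G : G `<=` ideal_gen G.
Proof. exact: sub_smallest. Qed.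

Lemma ideal_prodP s : is_ideal (ideal_prod s : set R).
Proof. by case: s => //= I s; apply: ideal_genP. Qed.

Lemma ideal_prod_mem (T : eqType) (s : seq T) (I : T -> set R) (F : T -> R) :
  (forall t, t \in s -> I t (F t)) -> ideal_prod (map I s) (\prod_(t <- s) F t).
Proof.
elim: s => //= t s IH FI; rewrite big_cons; apply: sub_ideal_gen.
exists (F t), (\prod_(j <- s) F j); split=> //; first by apply: FI; rewrite mem_head.
by apply: IH => j js; apply: FI; rewrite inE js orbT.
Qed.

Lemma bigcap_ideal (T : Type) (J : T -> set R) :
  (forall t, is_ideal (J t)) -> is_ideal [set f | forall t, J t f].
Proof.
move=> idJ; split=> [t|a b Ja Jb t|a b Jb t]; have [J0 JD JM] := idJ t => //.
  by apply: JD; [apply: Ja | apply: Jb].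
by apply: JM; apply: Jb.
Qed.

Lemma ideal_mul_sub I J Q : is_ideal Q ->
  (forall a b, I a -> J b -> Q (a * b)) -> ideal_mul I J `<=` Q.
Proof. by move=> idQ H; apply: ideal_gen_min => // x [a [b [Ia Jb ->]]]; apply: H. Qed.

End IdealFacts.

(** * Valuation ideals of an X-adic order, and symbolic powers *)

Section OrderFiltration.
Variables (R : comNzRingType) (S : idomainType) (phi : {rmorphism R -> {poly S}}).

Definition ord_ge (s : nat) : set R := [set f | exists g, phi f = 'X^s * g].

Lemma ord_ge_ideal s : is_ideal (ord_ge s).
Proof.
split.
- by exists 0; rewrite rmorph0 mulr0.
- by move=> a b [g E] [g' E']; exists (g + g'); rewrite rmorphD E E' mulrDr.
- by move=> a b [g E]; exists (phi a * g); rewrite rmorphM E mulrCA.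
Qed.

Lemma ord_ge0 f : ord_ge 0 f.
Proof. by exists (phi f); rewrite mul1r. Qed.

Lemma ord_geM s t f g : ord_ge s f -> ord_ge t g -> ord_ge (s + t) (f * g).
Proof. by move=> [a E] [b E']; exists (a * b); rewrite rmorphM E E' exprD; ring. Qed.

Lemma ord_geX s f k : ord_ge s f -> ord_ge (k * s) (f ^+ k).
Proof.
move=> fs; elim: k => [|k IH]; first exact: ord_ge0.
by rewrite mulSn exprS; apply: ord_geM.
Qed.

Lemma ord_ge_le s t f : (s <= t)%N -> ord_ge t f -> ord_ge s f.
Proof.
by move=> st [g E]; exists ('X^(t - s) * g); rewrite E mulrA -exprD subnKC.
Qed.

(** The constant term of [phi f] is nonzero and [S] is a domain, so the factors X of the product can
    be split off [phi g] one at a time. *)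
Lemma ord_ge_cancel s f g : ~ ord_ge 1 f -> ord_ge s (f * g) -> ord_ge s g.
Proof.
have X0 k : ('X^k : {poly S}) != 0 by rewrite expf_neq0 ?polyX_eq0.
move=> nf [h E]; suff: forall k, (k <= s)%N -> ord_ge k g by apply.
elim=> [|k IH] ks; first exact: ord_ge0.
have [g' Eg] := IH (ltnW ks); move: E; rewrite rmorphM Eg mulrCA.
rewrite -(subnKC (ltnW ks)) exprD -mulrA => /(mulfI (X0 k)).
have -> : (s - k = (s - k).-1.+1)%N by lia.
move=> /(congr1 (fun p => p.[0])).
rewrite hornerM exprS !hornerM hornerX !mul0r => /eqP.
rewrite mulf_eq0 => /orP[|] /eqP/rootP/factor_theorem[q Eq]; last first.
  by exists q; rewrite Eg Eq subr0 exprSr; ring.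
by case: nf; exists q; rewrite Eq subr0 mulrC.
Qed.

Lemma ord_ge_not1 s : (0 < s)%N -> ~ ord_ge s 1.
Proof.
move=> s0 [g /(congr1 (fun p => p.[0]))].
rewrite rmorph1 hornerM hornerC hornerXn expr0n gtn_eqF // mul0r => /eqP.
by rewrite oner_eq0.
Qed.

Lemma ord_ge_prime f g : ~ ord_ge 1 f -> ~ ord_ge 1 g -> ~ ord_ge 1 (f * g).
Proof. by move=> nf ng /(ord_ge_cancel nf). Qed.

Lemma ord_ge_primary s : (0 < s)%N -> primary_ideal (ord_ge s).
Proof.
move=> s0; split; first exact: ord_ge_ideal.
  by move=> E; apply: (ord_ge_not1 s0); rewrite E.
move=> a b ab; have [b1|nb] := pselect (ord_ge 1 b).
  by right; exists s; have := ord_geX s b1; rewrite muln1.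
by left; apply: (ord_ge_cancel nb); rewrite mulrC.
Qed.

End OrderFiltration.

(** Elements outside [I] have order 0, so clearing denominators preserves the order; conversely, the
    last hypothesis supplies a denominator. *)
Lemma symbolic_power_ord (R S : idomainType) (phi : {rmorphism R -> {poly S}})
    (I : set R) (s : nat) :
    I = ord_ge phi 1 -> ideal_exp I s `<=` ord_ge phi s ->
    (forall f, ord_ge phi s f -> exists b, ~ I b /\ ideal_exp I s (b * f)) ->
  symbolic_power I s = ord_ge phi s.
Proof.
move=> IE expV sat; have [V0 VD VM] := ord_ge_ideal phi s.
have b0 b : ~ I b -> tofrac b != 0.
  rewrite IE tofrac_eq0 => nb; apply/eqP => bE; apply: nb; rewrite bE.
  by have [] := ord_ge_ideal phi 1.
rewrite eqEsubset; split=> f.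
- case=> l [lP fE].
  (* By induction on the sum, it acquires a common denominator [b] of order 0 and a numerator of
     order at least [s]. *)
  have [b [g [nb Vg Eg]]] : exists b g, [/\ ~ ord_ge phi 1 b, ord_ge phi s g &
      tofrac b * (\sum_(p <- l) tofrac p.1 * p.2) = tofrac g].
    elim: l lP {fE} => [|p l IH] lP.
      exists 1, 0; split; [exact: ord_ge_not1 | exact: V0|].
      by rewrite big_nil mulr0 tofrac0.
    have [|b [g [nb Vg E]]] := IH.
      by move=> q ql; apply: lP; rewrite inE ql orbT.
    have [/expV Vp [a [b' [nb' pE]]]] := lP p (mem_head _ _).
    exists (b' * b), (b * (a * p.1) + b' * g); split.
    + by apply: ord_ge_prime nb; rewrite -IE.
    + by apply: VD; apply: (VM) => //; apply: (VM).
    + rewrite big_cons mulrDr pE tofracM tofracD !tofracM -mulrA -E mulrA.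
      congr (_ + _); last by rewrite mulrA.
      rewrite [_ / _]mulrC; set x := tofrac b'.
      rewrite (mulrC x) -mulrA [x * _]mulrCA [x * (_ * _)]mulrA.
      by rewrite divff ?b0 // mul1r [tofrac p.1 * _]mulrC.
  apply: (ord_ge_cancel nb).
  suff -> : b * f = g by [].
  by apply/eqP; rewrite -tofrac_eq tofracM fE; apply/eqP.
- move=> /sat[b [nb bf]]; exists [:: (b * f, tofrac 1 / tofrac b)]; split.
    by move=> p; rewrite inE => /eqP -> /=; split=> //; exists 1, b.
  by rewrite big_seq1 /= tofracM tofrac1 mul1r mulrAC mulfV ?mul1r ?b0.
Qed.

(** * Secant points and the order at a generic one *)

Section SecantPoint.
Variables (n c r : nat).

(* A general point of the [r]-secant variety: the sum of [r] points at which all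
   matrices X_t have rank 1.  Counting the variables from the last one makes the
   degenerations below polynomial in the parameter. *)
Definition secant_point (S : comNzRingType) (lam : 'I_r -> nat -> S) (z : 'I_r -> S)
    (a : 'I_n) : S :=
  \sum_l lam l ((n.-1 - a) %% c)%N * z l ^+ ((n.-1 - a) %/ c).

Definition perturbed_point (S : comNzRingType) (lam : 'I_r -> nat -> S)
    (z : 'I_r -> S) (eps : S) (x : 'I_n -> S) (a : 'I_n) : S :=
  secant_point lam z a + eps * x a.

(** Counted from the last variable, the index of an entry has a residue modulo [c] depending only on
    the column, and a quotient that is a row part plus a column part. So each summand of the secant
    point contributes a matrix of rank at most 1. *)
Lemma minor_perturbed_point (K : fieldType) (S : idomainType) (h : {rmorphism K -> S})
    lam z eps x t d : eps != 0 -> (0 < c)%N ->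
    minors t (hankel_mx K n c t) d ->
  exists q, mmap h (perturbed_point lam z eps x) d = eps ^+ (t - r) * q.
Proof.
move=> eps0 c0 [f [g [_ _ ->]]]; set P := perturbed_point lam z eps x.
rewrite -det_map_mx /=.
pose u (i j : 'I_t) := Ordinal (hankel_index_lt (f i) (g j)).
pose U : 'M[S]_(t, r) := \matrix_(i, l) z l ^+ (t.-1 - f i).
(* The index, counted from the last variable, of the entry of the last row in column [g j]; the
   column range prevents truncation. *)
pose m (j : 'I_t) := (n.-1 - g j - t.-1 * c)%N.
pose V : 'M[S]_(r, t) := \matrix_(l, j) (lam l (m j %% c)%N * z l ^+ (m j %/ c)).
have -> : map_mx (mmap h P) (mxsub f g (hankel_mx K n c t)) =
    U *m V + eps *: \matrix_(i, j) x (u i j).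
  apply/matrixP => i j; rewrite !mxE mmapX mmap1U /P /perturbed_point.
  congr (_ + _); apply: eq_bigr => l _; rewrite !mxE.
  have -> : (n.-1 - (g j + f i * c) = (t.-1 - f i) * c + m j)%N.
    have jn := ltn_ord (g j); have it := ltn_ord (f i).
    have : ((t.-1 - f i) * c + f i * c = t.-1 * c)%N by rewrite -mulnDl subnK //; lia.
    rewrite /m; move: jn; move: (nat_of_ord (g j)) => b; rewrite subn1.
    move: ((t.-1 - f i) * c)%N (f i * c)%N (t.-1 * c)%N => A B C; lia.
  by rewrite modnMDl divnMDl // exprD; ring.
exact: det_low_rank_perturbation.
Qed.

End SecantPoint.

Section GenericPoint.
Variables (K : fieldType) (n c r : nat).

(* [inl (l, k)] stands for [lam l k] if [k < c], and for [z l] if [k = c]. *)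
Definition param : finType := ('I_r * 'I_c.+1 + 'I_n)%type.

Local Notation G := {mpoly K[#|param|]}.

Definition param_var (u : param) : G := 'X_(enum_rank u).

Definition generic_point : 'I_n -> {poly G} :=
  perturbed_point c (fun l k => (param_var (inl (l, inord k)))%:P)
    (fun l => (param_var (inl (l, ord_max)))%:P) 'X (fun a => (param_var (inr a))%:P).

Definition generic_map : {rmorphism {mpoly K[n]} -> {poly G}} :=
  mmap (polyC \o @mpolyC #|param| K) generic_point.

Lemma mmap_rmorph (S T : comNzRingType) (h : {rmorphism K -> S}) (psi : {rmorphism S -> T})
    (p : 'I_n -> S) f : psi (mmap h p f) = mmap (psi \o h) (psi \o p) f.
Proof.
rewrite /mmap rmorph_sum; apply: eq_bigr => m _; rewrite rmorphM /=; congr (_ * _).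
by rewrite rmorph_prod; apply: eq_bigr => i _; rewrite rmorphXn.
Qed.

(** Consequently a factor ['X^s] of [generic_map f] becomes a factor [eps ^+ s] at every special
    point. *)
Lemma generic_map_specialize (T : comNzRingType) (h : {rmorphism K -> T})
    (lam : 'I_r -> nat -> T) z eps x : (0 < c)%N ->
  exists psi : {rmorphism {poly G} -> T},
    psi 'X = eps /\ forall f, psi (generic_map f) = mmap h (perturbed_point c lam z eps x) f.
Proof.
move=> c0; pose v (u : param) : T := match u with
  | inl (l, k) => if (k < c)%N then lam l k else z l | inr a => x a end.
pose psi0 : {rmorphism G -> T} := mmap h (v \o enum_val).
have psi0v u : psi0 (param_var u) = v u by rewrite /psi0 /= mmapX mmap1U /= enum_rankK.
pose psi : {rmorphism {poly G} -> T} := horner_eval eps \o map_poly psi0.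
have psiX : psi 'X = eps by rewrite /= map_polyX /horner_eval hornerX.
exists psi; split=> // f.
have psiC u : psi (param_var u)%:P = v u.
  by rewrite /= map_polyC /horner_eval hornerC; exact: psi0v.
rewrite /generic_map mmap_rmorph; rewrite /mmap; apply: eq_bigr => m _; congr (_ * _).
  by rewrite /= map_polyC /horner_eval hornerC /psi0 /= mmapC.
apply: mmap1_eq => a; rewrite /= /generic_point /perturbed_point /secant_point.
rewrite -[LHS]/(psi _) rmorphD rmorphM rmorph_sum psiX !psiC; congr (_ + _).
have lt := ltn_pmod (n.-1 - a) c0.
apply: eq_bigr => l _; rewrite rmorphM rmorphXn !psiC /= inordK ?(ltnW lt) //.
  by rewrite lt ltnn.
exact: ltnW.
Qed.
End GenericPoint.

(** * Exponential weights for the degeneration *)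

Section Weights.
Local Open Scope nat_scope.

(* [node c e x] is the number of [[e, e + c)] congruent to [x] modulo [c]. *)
Definition node_quo c e x := e %/ c + (x %% c < e %% c).
Definition node c e x := node_quo c e x * c + x %% c.

Lemma node_bounds c e x : 0 < c -> e <= node c e x < e + c.
Proof.
move=> c0; have := divn_eq e c; have := ltn_pmod e c0; have := ltn_pmod x c0.
rewrite /node /node_quo mulnDl; move: (x %% c) (e %% c) (e %/ c * c) => u v w.
by case: (ltnP u v) => ?; rewrite ?mul1n ?mul0n; lia.
Qed.

(* By convexity of [b ^ x], extrapolating linearly from [[e, e + c]] along the
   residue class of [x] modulo [c] stays below [b ^ x], strictly outside of
   [[e, e + c]]. *)
Lemma weight_extrapolation (b c e x : nat) (th := b ^ (e + c) - b ^ e) :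
    0 < c -> x.+1 < b ->
  b ^ node c e x + th * (x %/ c) <= b ^ x + th * node_quo c e x
    ?= iff (e <= x <= e + c).
Proof.
move=> c0 xb; set p := node_quo c e x; set y := node c e x; set q := x %/ c.
have b1 : 1 < b by lia.
have xE : x = q * c + x %% c by exact: divn_eq.
have yE : y = p * c + x %% c by [].
have /andP[ey ye] : e <= y < e + c by apply: node_bounds.
have thE : th + b ^ e = b ^ (e + c) by rewrite subnK // leq_exp2l // leq_addr.
have yec : b ^ y < b ^ (e + c) by rewrite ltn_exp2l.
case: (ltngtP q p) => [qp|pq|qp].
- have xy : x + c <= y.
    by rewrite xE yE addnAC leq_add2r -mulSnr leq_mul2r qp orbT.
  rewrite (_ : (e <= x <= e + c) = false); last by lia.
  have lt : b ^ y + th * q < b ^ x + th * p.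
    have : th * q.+1 <= th * p by rewrite leq_mul2l qp orbT.
    have : b ^ y <= th.
      have : b * b ^ (e + c).-1 = b ^ (e + c) by rewrite -expnS prednK //; lia.
      have : 2 * b ^ (e + c).-1 <= b * b ^ (e + c).-1 by rewrite leq_mul2r b1 orbT.
      have : b ^ y <= b ^ (e + c).-1 by rewrite leq_exp2l //; lia.
      have : b ^ e <= b ^ (e + c).-1 by rewrite leq_exp2l //; lia.
      lia.
    have : 0 < b ^ x by rewrite expn_gt0; lia.
    by rewrite mulnS; lia.
  by split; [exact: ltnW | rewrite ltn_eqF].
- have xy : y + c <= x.
    by rewrite xE yE addnAC leq_add2r -mulSnr leq_mul2r pq orbT.
  (* The right end [e + c] is extrapolated from [e]; equality there is the choice of [th]. *)
  have [xec|xec] := leqP x (e + c).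
    have {}xec : x = e + c by lia.
    have {}ye : y = e by lia.
    have qE : q = p.+1.
      apply/eqP; rewrite -(eqn_pmul2r c0); apply/eqP.
      by rewrite mulSnr; lia.
    rewrite ye xec leq_addr /= qE mulnS; split; last by apply/eqP; lia.
    by lia.
  rewrite andbF.
  have lt : b ^ y + th * q < b ^ x + th * p.
    have : th * q = th * p + th * (q - p) by rewrite -mulnDr subnKC // ltnW.
    have : th * (q - p) <= b ^ (e + c) * (q - p) by rewrite leq_mul2r; lia.
    (* This is where [x.+1 < b] enters: one more power of [b] outweighs all the linear steps. *)
    have qb : (q - p).+1 <= b by have := leq_div x c; rewrite -/q; lia.
    have : (q - p).+1 * b ^ (e + c) <= b * b ^ (e + c) by rewrite leq_mul2r qb orbT.
    have : b ^ (e + c).+1 <= b ^ x by rewrite leq_exp2l.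
    by rewrite expnS mulSn (mulnC (q - p)); lia.
  by split; [exact: ltnW | rewrite ltn_eqF].
- have xy : x = y by rewrite xE yE qp.
  have -> : (e <= x <= e + c) by rewrite xy ey ltnW.
  by rewrite -xy qp; split=> //; rewrite eqxx.
Qed.

End Weights.

(** * Top coefficients and weighted degrees *)

Section TopCoefficient.
Variable A : comNzRingType.
Implicit Types p q : {poly A}.

(** The value [b] may be 0, so products need no condition on leading coefficients. *)
Definition top_coef (d : nat) p (b : A) := (size p <= d.+1)%N /\ p`_d = b.

Lemma top_coefM d e p q a b : top_coef d p a -> top_coef e q b -> top_coef (d + e) (p * q) (a * b).
Proof.
move=> [sp <-] [sq <-]; split.
  by apply: leq_trans (size_polyMleq _ _) _; lia.
have dlt : (d < (d + e).+1)%N by rewrite ltnS leq_addr.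
rewrite coefM (bigD1 (Ordinal dlt)) //= addKn big1 ?addr0 // => i.
rewrite -val_eqE /= => ni; have [lt|le] := ltnP i d.
  by rewrite [q`_ _]nth_default ?mulr0 //; apply: leq_trans sq _; move: lt => /= lt; lia.
rewrite nth_default ?mul0r //; apply: leq_trans sp _.
by move: ni le => /= ni le; rewrite ltn_neqAle eq_sym ni.
Qed.

Lemma top_coef1 : top_coef 0 1 1.
Proof. by split; rewrite ?size_poly1 ?coef1. Qed.

Lemma top_coefX d p a k : top_coef d p a -> top_coef (k * d) (p ^+ k) (a ^+ k).
Proof.
by move=> tp; elim: k => [|k IH]; [exact: top_coef1 | rewrite mulSn !exprS; apply: top_coefM].
Qed.

Lemma top_coef_mmap n (K : fieldType) (h : {rmorphism K -> A}) (Y : 'I_n -> {poly A})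
    (w : 'I_n -> nat) (b : 'I_n -> A) (f : {mpoly K[n]}) (M : 'X_{1..n}) :
    (forall a, top_coef (w a) (Y a) (b a)) ->
    (forall m, m \in msupp f -> m != M ->
       \sum_a m a * w a < \sum_a M a * w a)%N ->
  (mmap (polyC \o h) Y f)`_(\sum_a M a * w a)%N = h f@_M * \prod_a b a ^+ M a.
Proof.
move=> tY wM.
have tm (m : 'X_{1..n}) : top_coef (\sum_a m a * w a)%N (mmap1 Y m) (\prod_a b a ^+ m a).
  rewrite /mmap1; elim/big_rec3: _ => [|a x y z _ t]; first exact: top_coef1.
  by apply: top_coefM => //; apply: top_coefX.
rewrite /mmap coef_sum.
have [Mf|Mf] := boolP (M \in msupp f).
  rewrite (bigD1_seq M) ?msupp_uniq //= coefCM (tm M).2 [X in _ + X]big_seq_cond [X in _ + X]big1 ?addr0 //.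
  move=> m /andP[mf mM]; rewrite coefCM nth_default ?mulr0 //.
  by apply: leq_trans (tm m).1 _; apply: wM.
rewrite (memN_msupp_eq0 Mf) rmorph0 mul0r big_seq big1 // => m mf.
rewrite coefCM nth_default ?mulr0 //; apply: leq_trans (tm m).1 _; apply: wM => //.
by apply: contraNneq Mf => <-.
Qed.

End TopCoefficient.

(** The term [N] compares degrees first; at equal degree, exponents are below [b] and act as digits
    in base [b]. *)
Lemma weight_lt n (b N : nat) (m M : 'X_{1..n}) :
    (m < M)%O -> (mdeg m < b)%N -> (b ^ n <= N)%N ->
  (\sum_(a < n) m a * (N + b ^ (n.-1 - a)) < \sum_(a < n) M a * (N + b ^ (n.-1 - a)))%N.
Proof.
move=> mM mb bN.
have b0 : (0 < b)%N by apply: leq_ltn_trans mb.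
have wE (m' : 'X_{1..n}) : (\sum_(a < n) m' a * (N + b ^ (n.-1 - a)) =
    mdeg m' * N + \sum_(a < n) m' a * b ^ (n.-1 - a))%N.
  by rewrite mdegE big_distrl -big_split; apply: eq_bigr => a _; rewrite mulnDr.
rewrite !wE; have := lemc_mdeg (ltW mM); rewrite leq_eqVlt => /predU1P[dmM|lt].
  rewrite dmM ltn_add2l; have /(ltmcP dmM)[i eqi lti] := mM.
  rewrite (bigD1 i) //= [X in (_ < X)%N](bigD1 i) //=.
  rewrite (bigID (fun a : 'I_n => a < i)%N) /= [X in (_ < _ + X)%N](bigID (fun a : 'I_n => a < i)%N) /=.
  rewrite [X in (_ + (X + _) < _)%N](eq_bigr (fun a : 'I_n => M a * b ^ (n.-1 - a))%N); last first.
    by move=> a /andP[_ /eqi ->].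
  set S := (\sum_(a | (a != i) && (a < i)) _)%N.
  set S' := (\sum_(a | _) _)%N; set S'' := (\sum_(a | _) _)%N.
  have S'b : (S' < b ^ (n.-1 - i))%N.
    rewrite -(ltn_pmul2l b0); apply: (@leq_ltn_trans (mdeg m * b ^ (n.-1 - i))).
      rewrite mdegE !big_distrl /S' big_distrr /= [X in (_ <= X)%N](bigID (fun a : 'I_n => (a != i) && ~~ (a < i))%N) /=.
      apply: leq_trans (leq_addr _ _); apply: leq_sum => a /andP[ai ia].
      rewrite mulnCA leq_mul2l -expnS leq_pexp2l ?orbT //.
      move: ai ia (ltn_ord a); rewrite -val_eqE /= => ? ? ?; lia.
    by rewrite ltn_pmul2r ?expn_gt0 ?b0.
  have : ((m i).+1 * b ^ (n.-1 - i) <= M i * b ^ (n.-1 - i))%N by rewrite leq_mul2r lti orbT.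
  by rewrite mulSn; lia.
have : ((mdeg m).+1 * N <= mdeg M * N)%N by rewrite leq_mul2r lt orbT.
suff : (\sum_(a < n) m a * b ^ (n.-1 - a) < N)%N by rewrite mulSn; lia.
apply: leq_trans bN.
have [n0|n0] := posnP n.
  by rewrite big1 ?expn_gt0 ?b0 // => a; move: (ltn_ord a); rewrite {2}n0.
apply: (@leq_ltn_trans (mdeg m * b ^ n.-1)).
  rewrite mdegE big_distrl /=; apply: leq_sum => a _; rewrite leq_mul2l leq_pexp2l ?orbT //.
  by rewrite leq_subr.
by rewrite -[X in (_ < b ^ X)%N](prednK n0) expnS ltn_pmul2r ?expn_gt0 ?b0.
Qed.

(** The intervals are disjoint, so at most one summand of the secant point reaches the top weight at
    each index. *)
Lemma count_cover c F a : sorted (far c) F ->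
  count (fun e => a <= e <= a + c)%N F = covered c F a.
Proof.
elim: F => [//|e F IH]; rewrite covered_cons /= path_sortedE; last exact: far_trans.
move=> /andP[/allP eF /IH ->]; case: (boolP (_ <= e <= _)%N) => //= ae.
case: (boolP (covered _ _ _)) => // /hasP[e' /eF]; rewrite /far; lia.
Qed.

(* Substitute powers of a new variable T so that the l-th summand of the secant
   point reaches the weight T^(w a) exactly for [a] in the l-th interval of [F];
   the top coefficient in T of f(y + eps x) is then the leading coefficient of f
   times the product of the ([covered c F a] + eps)^(M a). *)
Lemma ord_ge_mlead (K : fieldType) n c r s (f : {mpoly K[n]}) F :
    (0 < c)%N -> f != 0 -> ord_ge (generic_map K n c r) s f ->
    chain n c F -> (size F <= r)%N ->
  (s <= \sum_(a < n | ~~ covered c F a) mlead f a)%N.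
Proof.
move=> c0 f0 [g fg] /andP[sF /allP ltF] Fr; set M := mlead f.
(* [b] exceeds the degree of [f] and the indices; [N] dominates [b ^ n] and keeps the subtraction in
   [lam] from being truncated. *)
pose b := (n + msize f).+2; pose N := (b ^ (n + c) * (n + c))%N.
pose w (a : 'I_n) := (N + b ^ (n.-1 - a))%N.
(* Counting from the last variable turns the right end of an interval into its left end. *)
pose e (l : 'I_r) := (n.-1 - nth 0%N F l)%N.
pose th (l : 'I_r) := (b ^ (e l + c) - b ^ e l)%N.
pose lam (l : 'I_r) k : {poly {poly K}} :=
  if (l < size F)%N then 'X^(N + b ^ node c (e l) k - th l * node_quo c (e l) k) else 0.
pose z (l : 'I_r) : {poly {poly K}} := 'X^(th l).
have [psi [psiX psiE]] := generic_map_specialize (polyC \o (@polyC K)) lam z 'X%:P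
  (fun a => 'X^(w a)) c0.
have tY a : top_coef (w a) (perturbed_point c lam z 'X%:P (fun a => 'X^(w a)) a)
    ((covered c F a)%:R + 'X).
  pose x := (n.-1 - a)%N.
  pose cov (l : 'I_r) := (l < size F)%N && (a <= nth 0%N F l <= a + c)%N.
  have tl l : top_coef (w a) (lam l (x %% c)%N * z l ^+ (x %/ c)) (cov l)%:R.
    rewrite /lam /cov; case: ltnP => [lF|_] /=; last first.
      by rewrite mul0r; split; rewrite ?size_poly0 ?coef0.
    have eF : (nth 0%N F l < n)%N by apply/ltF/mem_nth.
    have xb : (x.+1 < b)%N by rewrite /x /b; have := ltn_ord a; move: (msize f) => ?; lia.
    have [le eq] := weight_extrapolation (e l) c0 xb.
    have NE : (node c (e l) (x %% c) = node c (e l) x) by rewrite /node /node_quo modn_mod.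
    have QE : (node_quo c (e l) (x %% c) = node_quo c (e l) x) by rewrite /node_quo modn_mod.
    rewrite -exprM -exprD NE QE -/(th l) in le eq *.
    have thN : (th l * node_quo c (e l) x <= N)%N.
      apply: (@leq_trans (b ^ (e l + c) * node_quo c (e l) x)).
        by rewrite leq_mul2r leq_subr orbT.
      apply: leq_mul; first by rewrite leq_exp2l // leq_add2r /e; lia.
      have /andP[_ ye] := node_bounds (e l) x c0.
      have : (node_quo c (e l) x <= node_quo c (e l) x * c)%N by rewrite leq_pmulr.
      by move: ye; rewrite /node /e; lia.
    have -> : (nth 0 F l >= a)%N && (nth 0 F l <= a + c)%N = (e l <= x <= e l + c)%N.
      by move: (ltn_ord a); rewrite /e /x; lia.
    rewrite -eq; split; first by rewrite size_polyXn ltnS /w -/x; lia.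
    by rewrite coefXn /w -/x; congr (_%:R); congr nat_of_bool; lia.
  split.
    apply: leq_trans (size_polyD _ _) _; rewrite geq_max; apply/andP; split.
      apply: leq_trans (size_sum _ _ _) _; apply/bigmax_leqP => l _; exact: (tl l).1.
    apply: leq_trans (size_polyMleq _ _) _; rewrite size_polyXn addnS /=.
    by rewrite -add1n leq_add2r size_polyC_leq1.
  rewrite coefD coefCM coefXn eqxx mulr1 coef_sum; congr (_ + _).
  rewrite (eq_bigr (fun l => (cov l)%:R)) => [|l _]; last exact: (tl l).2.
  rewrite -natr_sum -(count_cover a sF) -sum1_count (big_nth 0%N) big_mkord.
  rewrite (big_ord_widen_cond r (fun i => a <= nth 0 F i <= a + c)%N (fun=> 1%N) Fr).
  congr (_%:R); rewrite [RHS]big_mkcond; apply: eq_bigr => l _.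
  by rewrite /cov andbC; case: (_ && _).
have wM (m : 'X_{1..n}) : m \in msupp f -> m != M -> (\sum_a m a * w a < \sum_a M a * w a)%N.
  move=> mf mM; apply: weight_lt.
  - by rewrite lt_neqAle mM; apply: msupp_le_mlead.
  - by have := msize_mdeg_lt mf; rewrite /b; lia.
  - apply: (@leq_trans (b ^ (n + c))); first by rewrite leq_exp2l // leq_addr.
    by rewrite leq_pmulr // addn_gt0 c0 orbT.
have := top_coef_mmap polyC tY wM; rewrite -psiE fg rmorphM rmorphXn psiX.
rewrite -rmorphXn coefCM => E.
set u := (\sum_(a | _) _)%N; rewrite leqNgt; apply/negP => us.
have fM : f@_M != 0 by rewrite -mcoeff_msupp mlead_supp.
have X0 : ('X^u : {poly K}) != 0 by rewrite expf_neq0 ?polyX_eq0.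
move: E; rewrite [X in _ = _ * X](bigID (fun a : 'I_n => covered c F a)) /=.
have -> : \prod_(a < n | ~~ covered c F a) ((covered c F a)%:R + 'X) ^+ M a = 'X^u :> {poly K}.
  rewrite /u expr_sum; apply: eq_bigr => a /negPf ->; by rewrite add0r.
have -> : 'X^s = 'X^u * 'X^(s - u) :> {poly K} by rewrite -exprD subnKC // ltnW.
rewrite -mulrA [X in _ = _ * X]mulrC [RHS]mulrCA => /(mulfI X0).
(* After cancelling ['X^u], set eps to 0: one side is 0 since [u < s], the other is the leading
   coefficient of [f]. *)
move=> /(congr1 (fun p => p.[0])); rewrite !hornerM hornerXn expr0n.
rewrite subn_eq0 leqNgt us mul0r hornerC => /esym/eqP.
rewrite horner_prod big1 ?mulr1 ?(negPf fM) // => a ->.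
by rewrite !hornerE expr1n.
Qed.

(** Subtracting a scalar multiple of [g] cancels the leading term and stays in [Q]; the monomial
    order is well founded. *)
Lemma sub_ideal_by_mlead n (K : fieldType) (J Q : set {mpoly K[n]}) :
    is_ideal J -> is_ideal Q -> J `<=` Q ->
    (forall f, Q f -> f != 0 -> exists g, [/\ J g, mlead g = mlead f & mleadc g = 1]) ->
  Q `<=` J.
Proof.
move=> [J0 JD JM] [_ QD QM] JQ lead f; elim/mleadrect: f => f IH Qf.
have [->//|f0] := eqVneq f 0; have [g [Jg gM gc]] := lead f Qf f0.
have Jcg : J ((mleadc f)%:MP * g) by apply: JM.
rewrite -(subrK ((mleadc f)%:MP * g) f); apply: JD => //.
set q := f - _; have Qq : Q q.
  by apply: QD => //; rewrite -mulN1r; apply/QM/JQ.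
have [->//|q0] := eqVneq q 0; apply: IH => //.
rewrite lt_neqAle; apply/andP; split; last first.
  apply: le_trans (mleadB_le _ _) _; rewrite leUx lexx mul_mpolyC -gM.
  exact: mleadZ_le.
apply: contra_neq q0 => qf; apply/eqP; rewrite -mleadc_eq0 qf.
by rewrite mcoeffB mcoeffCM -{3}gM gc mulr1 subrr.
Qed.

(** * Products of the ideals [I t] and their symbolic powers *)

Section Main.
Variables (K : fieldType) (n c : nat).
Hypothesis c0 : (0 < c)%N.
Local Notation I := (hankel_ideal K n c).
Local Notation V r := (ord_ge (generic_map K n c r)).
Implicit Types (f g : {mpoly K[n]}) (tau : seq nat).

Lemma hankel_ideal_ord t r : I t `<=` V r (t - r).
Proof.
apply: ideal_gen_min; first exact: ord_ge_ideal.
by move=> d /(minor_perturbed_point _ _ _ _) H; apply: H; rewrite ?polyX_eq0.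
Qed.

Lemma hankel_prod_ord tau r :
  ideal_prod [seq I t | t <- tau] `<=` V r (\sum_(t <- tau) (t - r)).
Proof.
elim: tau => [|t tau IH] /=; first by rewrite big_nil => f _; exact: ord_ge0.
rewrite big_cons; apply: ideal_mul_sub; first exact: ord_ge_ideal.
by move=> a b /hankel_ideal_ord Ia /IH Jb; apply: ord_geM; first exact: Ia.
Qed.

Lemma chain_minor_mem (s : seq nat) : chain n c s ->
  exists d, [/\ I (size s) d, mlead d = mnm_of_seq n s & mleadc d = 1].
Proof.
move=> /(chain_minor K c0) [d [dm dl dc]]; exists d; split=> //.
exact: sub_ideal_gen.
Qed.

Lemma hankel_prod_eq tau f :
  (forall r, V r (\sum_(t <- tau) (t - r)) f) ->
  ideal_prod [seq I t | t <- tau] f.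
Proof.
set J := ideal_prod _; pose Q := [set f | forall r, V r (\sum_(t <- tau) (t - r)) f].
suff : Q `<=` J by apply.
apply: sub_ideal_by_mlead; first exact: ideal_prodP.
- by apply: bigcap_ideal => r; apply: ord_ge_ideal.
- by move=> g Jg r; apply: hankel_prod_ord.
move=> {}f Qf f0; pose k := size tau; pose t (i : 'I_k) := nth 0%N tau i.
have tauE : tau = [seq t i | i <- enum 'I_k].
  by rewrite (map_comp (nth 0%N tau) val) val_enum_ord map_nth_iota0 ?take_size.
have [|C [HC [M' ME]]] := @mnm_chains n c k t (mlead f).
  (* Each chain [F] is tested on the secant variety with [r = size F]. *)
  move=> F chF; have := ord_ge_mlead c0 f0 (Qf (size F)) chF (leqnn _).
  by rewrite tauE big_map big_enum.
have /fin_all_exists[d Hd] : forall i, exists d,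
    [/\ I (t i) d, mlead d = mnm_of_seq n (C i) & mleadc d = 1].
  by move=> i; have [/chain_minor_mem[d]] := HC i; move=> + E; rewrite E; exists d.
have d0 i : d i != 0 by rewrite -mleadc_eq0; have [_ _ ->] := Hd i; rewrite oner_eq0.
have pl : mlead (\prod_i d i) = (\sum_i mnm_of_seq n (C i))%MM.
  by rewrite mlead_prod //; apply: eq_bigr => i _; have [] := Hd i.
have P0 : \prod_i d i != 0 by apply/prodf_neq0.
have X0 : ('X_[M'] : {mpoly K[n]}) != 0.
  by rewrite -mleadc_eq0 mleadXm mcoeffX eqxx oner_eq0.
exists ('X_[M'] * \prod_i d i); split.
- have [_ _ JM] := ideal_prodP [seq I t | t <- tau]; apply: JM.
  rewrite tauE -map_comp -big_enum; apply: ideal_prod_mem => i _ /=.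
  by have [] := Hd i.
- by rewrite mleadM // mleadXm pl ME.
- rewrite mleadM // mleadcM mleadXm mcoeffX eqxx mul1r pl.
  have <- : (\sum_i mlead (d i))%MM = (\sum_i mnm_of_seq n (C i))%MM.
    by apply: eq_bigr => i _; have [] := Hd i.
  by rewrite mleadc_prod big1 // => i _; have [] := Hd i.
Qed.

Lemma hankel_idealE j : (0 < j)%N -> I j = V j.-1 1.
Proof.
move=> j0; have IV : I j `<=` V j.-1 1.
  have -> : (1 = j - j.-1)%N by lia.
  exact: hankel_ideal_ord.
rewrite eqEsubset; split; first exact: IV.
apply: (sub_ideal_by_mlead (ideal_genP _) (ord_ge_ideal _ _) IV).
move=> f Vf f0; have [F chF Fj|C [chC Cj [M' ME]]] := @mnm_chain n c j (mlead f).
  have := ord_ge_mlead c0 f0 Vf chF; rewrite -ltnS prednK // => /(_ Fj).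
  rewrite lt0n sum_nat_eq0 => /forallPn[i]; rewrite negb_imply => /andP[ci Mi].
  by exists i; rewrite ?lt0n.
have [d [Id dl dc]] := chain_minor_mem chC; rewrite Cj in Id.
have d0 : d != 0 by rewrite -mleadc_eq0 dc oner_eq0.
have X0 : ('X_[M'] : {mpoly K[n]}) != 0.
  by rewrite -mleadc_eq0 mleadXm mcoeffX eqxx oner_eq0.
exists ('X_[M'] * d); split.
- by have [_ _ JM] := ideal_genP (minors j (hankel_mx K n c j)); apply: JM.
- by rewrite mleadM // mleadXm dl ME.
- by rewrite mleadM // mleadcM mleadXm mcoeffX eqxx mul1r.
Qed.

(** The diagonal of multiples of [c + 1] fits below [n] and is covered by its own intervals, so its
    minor has order 0. *)
Lemma exists_generic_minor r : (r <= (n + c) %/ c.+1)%N ->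
  exists2 d, I r d & ~ V r 1 d.
Proof.
move=> rm; pose s := rev [seq i * c.+1 | i <- iota 0 r]%N.
have chs : chain n c s.
  rewrite /chain rev_sorted sorted_map; apply/andP; split.
    apply: sub_sorted (iota_ltn_sorted 0 r) => x y /= xy.
    by have := leq_mul2r c.+1 x.+1 y; rewrite /far xy orbT mulSn; lia.
  apply/allP => x; rewrite mem_rev => /mapP[i]; rewrite mem_iota => /andP[_ ir] ->.
  have : (i.+1 * c.+1 <= r * c.+1)%N by rewrite leq_mul2r orbC ir.
  have : (r * c.+1 <= n + c)%N by rewrite -leq_divRL.
  by rewrite mulSn /=; lia.
have [d [Id dl dc]] := chain_minor_mem chs.
have sr : size s = r by rewrite size_rev size_map size_iota.
exists d; first by rewrite -sr.
have d0 : d != 0 by rewrite -mleadc_eq0 dc oner_eq0.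
move=> Vd; have := ord_ge_mlead c0 d0 Vd chs; rewrite sr leqnn => /(_ isT).
rewrite big1 // => i; rewrite dl mnmE => nc; apply/eqP; rewrite -leqn0 leqNgt.
rewrite -has_count has_pred1; apply: contra nc => is_; apply/hasP; exists (val i) => //.
by rewrite leqnn leq_addr.
Qed.

Lemma symbolic_powerE j s : (0 < j <= ((n + c) %/ c.+1).+1)%N ->
  symbolic_power (I j) s = V j.-1 s.
Proof.
move=> /andP[j0 jm]; have IE := hankel_idealE j0.
have expV : ideal_exp (I j) s `<=` V j.-1 s.
  have := @hankel_prod_ord (nseq s j) j.-1; rewrite map_nseq.
  have -> // : (\sum_(t <- nseq s j) (t - j.-1) = s)%N.
  by rewrite big_nseq; elim: s => //= s ->; lia.
have [d Id nd] : exists2 d, I j.-1 d & ~ V j.-1 1 d by apply: exists_generic_minor; lia.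
apply: symbolic_power_ord => // f Vf.
have nb k : ~ V j.-1 1 (d ^+ k).
  elim: k => [|k IH]; first exact: ord_ge_not1.
  by rewrite exprS; apply: ord_ge_prime.
(* For [r < j.-1] the factor 2 suffices, as [j - r <= 2 * (j.-1 - r)]; at [r = j.-1] the order comes
   from [f], and beyond it the condition is empty. *)
exists (d ^+ (2 * s)); split; first (rewrite IE; exact: nb).
have := @hankel_prod_eq (nseq s j) (d ^+ (2 * s) * f); rewrite map_nseq; apply=> r.
have -> : (\sum_(t <- nseq s j) (t - r) = s * (j - r))%N.
  by rewrite big_nseq; elim: (s) => //= s' ->; rewrite mulSn.
have [rj|jr] := ltnP r j.-1.
  apply: (@ord_ge_le _ _ _ _ (2 * s * (j.-1 - r) + 0)).
    rewrite addn0 (mulnC 2%N) -mulnA leq_mul2l; apply/orP; right; lia.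
  by apply: ord_geM (ord_ge0 _ _); apply: ord_geX; exact: hankel_ideal_ord.
have [->|jr'] := eqVneq r j.-1.
  have -> : (s * (j - j.-1) = 0 + s)%N by rewrite (_ : j - j.-1 = 1)%N ?muln1 //; lia.
  exact: ord_geM (ord_ge0 _ _) Vf.
have -> : (s * (j - r) = 0)%N by rewrite (_ : j - r = 0)%N ?muln0 //; lia.
exact: ord_ge0.
Qed.

End Main.

Theorem theorem3p25 (K : fieldType) (n c : nat) (hn : (1 <= n)%N) (hc : (1 <= c)%N)
    (tau : seq nat) (tau_ne : tau <> [::]) (tau_dec : sorted geq tau)
    (tau_bd : forall t : nat, t \in tau -> (1 <= t <= (n + c) %/ (c + 1))%N) :
  let I := hankel_ideal K n c in
  let t1 := head 0%N tau in
  let D := [set j : nat | (1 <= j <= t1)%N] in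
  let Q := fun j : nat => symbolic_power (I j) (gamma j tau) in
  ideal_prod [seq I t | t <- tau] = \bigcap_(j in D) Q j /\
  primary_decomposition (ideal_prod [seq I t | t <- tau]) D Q.
Proof.
move=> I t1 D Q.
have t1tau : t1 \in tau by rewrite /t1; case: (tau) tau_ne => // t s _; exact: mem_head.
have tau_le t : t \in tau -> (t <= t1)%N.
  move: tau_dec; rewrite /t1; case: (tau) => //= t' s.
  rewrite path_sortedE; last exact: rev_trans leq_trans.
  by case/andP=> /allP le _; rewrite inE => /predU1P[->|/le].
have gammaE r : gamma r.+1 tau = (\sum_(t <- tau) (t - r))%N.
  by apply: eq_bigr => t _; rewrite addn1 subSS.
have QE j : D j -> Q j = ord_ge (generic_map K n c j.-1) (gamma j tau).
  move=> /andP[j0 jt]; apply: symbolic_powerE => //; rewrite j0 /=.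
  by have := tau_bd _ t1tau; rewrite addn1; lia.
have E : ideal_prod [seq I t | t <- tau] = \bigcap_(j in D) Q j.
  apply/seteqP; split=> f.
    move=> If j Dj; rewrite (QE _ Dj); case: j Dj => // j Dj.
    by rewrite gammaE; apply: hankel_prod_ord.
  (* Index [j] corresponds to [r = j - 1]; for [r >= t1] the required order is 0. *)
  move=> Qf; apply: hankel_prod_eq => // r; have [rt|tr] := ltnP r t1.
    by have := Qf r.+1 rt; rewrite QE // gammaE.
  rewrite big_seq big1; first exact: ord_ge0.
  by move=> t /tau_le; lia.
split=> //; split=> //.
  apply: (@sub_finite_set _ _ `I_t1.+1); last exact: finite_II.
  by move=> j /andP[].
(* The summand of [t1] makes the exponent positive, hence the ideal proper. *)
move=> j Dj; rewrite (QE _ Dj); apply: ord_ge_primary.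
have /andP[j0 jt] := Dj.
by rewrite /gamma (big_rem t1) //= addn_gt0; apply/orP; left; lia.
Qed.
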